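(* Let $G$ be a connected unicyclic graph of order $n$. Then $\xi(C_n)\le \xi(G)\le \xi(U_n)$.
   Context: All graphs are finite, simple and undirected. A connected unicyclic graph is a connected graph containing exactly one cycle. The independence polynomial of a graph $G$ is $I(G,x)=\sum_{k\ge 0} i_kx^k$, where $i_k$ is the number of independent sets of size $k$ in $G$. It is known that the root of $I(G,x)$ of smallest modulus is real and lies in $[-1,0)$; it is denoted $\xi(G)$ (equivalently, $\xi(G)$ is the largest real root of $I(G,x)$). $C_n$ ($n\ge 3$) is the cycle on $n$ vertices. $U_n$ ($n\ge 3$) is the graph on $n$ vertices obtained from a triangle by attaching $n-3$ pendant vertices (leaves) to one fixed vertex of the triangle. *)

(* Defs.v *)
From mathcomp Require Import all_boot all_order all_algebra.
From mathcomp Require Import complex.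
From mathcomp Require Import classical_sets reals.

Set Implicit Arguments.
Unset Strict Implicit.
Unset Printing Implicit Defensive.

Import Order.TTheory GRing.Theory Num.Theory.
Local Open Scope ring_scope.
Local Open Scope complex_scope.

Definition simple_graph (T : finType) (e : rel T) : Prop :=
  symmetric e /\ irreflexive e.

Definition connected_graph (T : finType) (e : rel T) : Prop :=
  (0 < #|T|)%N /\ forall x y : T, connect e x y.

(* A cycle of a graph is a subgraph, represented by its edge set, so that the
   vertex sequences that differ by a rotation or a reversal give one cycle. *)
Definition cycle_edges (T : finType) (c : seq T) : {set {set T}} :=
  [set [set x; next c x] | x in c].

Definition is_cycle_of (T : finType) (e : rel T) (C : {set {set T}}) : Prop :=
  exists c : seq T, [/\ ucycle e c, (2 < size c)%N & C = cycle_edges c].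

Definition connected_unicyclic (T : finType) (e : rel T) : Prop :=
  [/\ simple_graph e, connected_graph e
    & exists! C : {set {set T}}, is_cycle_of e C].

Definition independent (T : finType) (e : rel T) (S : {set T}) : bool :=
  [forall x in S, forall y in S, ~~ e x y].

Definition num_independent (T : finType) (e : rel T) (k : nat) : nat :=
  #|[set S : {set T} | independent e S & #|S| == k]|.

Definition indep_poly (A : nzRingType) (T : finType) (e : rel T) : {poly A} :=
  \poly_(k < #|T|.+1) (num_independent e k)%:R.

(* [x] is a root, and has the smallest modulus among all complex roots. *)
Definition smallest_modulus_root (R : realType) (T : finType) (e : rel T)
    (x : R) : Prop :=
  root (indep_poly _ e) x%:C /\
  forall z : R[i], root (indep_poly _ e) z -> `|x%:C| <= `|z|.

(* On a nonempty graph exactly one real number satisfies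
   [smallest_modulus_root]; the default value 0 is never a root. *)
Definition xi (R : realType) (T : finType) (e : rel T) : R :=
  xget 0 (fun x : R => smallest_modulus_root e x).

Definition cycle_graph (n : nat) : rel 'I_n :=
  fun i j => (j == ordS i) || (i == ordS j).

(* The triangle is {0, 1, 2} and the vertices 3, ..., n - 1 are leaves
   attached to 0. *)
Definition triangle_with_leaves (n : nat) : rel 'I_n :=
  fun i j => (i != j) &&
    [|| i == 0%N :> nat, j == 0%N :> nat | (i < 3)%N && (j < 3)%N].

(* Main.v *)
Require Import Defs.
From mathcomp Require Import all_boot all_order all_algebra.
From mathcomp Require Import complex polyrcf.
From mathcomp Require classical_sets.
From mathcomp Require Import reals.
From mathcomp Require Import zify ring lra.

Set Implicit Arguments.
Unset Strict Implicit.
Unset Printing Implicit Defensive.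

Import Order.TTheory GRing.Theory Num.Theory.
Local Open Scope ring_scope.

(* Write [f S] for the independence polynomial of the subgraph induced by [S],
   evaluated at [- q], and let [r] be the first positive zero of [f setT]. Deleting
   vertices one at a time shows that [f] is positive on all induced subgraphs for
   [0 <= q < r] and that [|f|] at a complex point [z] with [|z| = q] is at least
   [f] at [- q]; hence [xi = - r].

   A connected unicyclic graph is its cycle (which is chordless) with leaves added
   one at a time.

   Upper bound: [f] decreases with the vertex set as long as it is nonnegative, so
   adding a leaf [u] at [w] subtracts [q f (S - w)] from [f S], which is at most the
   loss in [U_n]; thus [f] of [G] dominates [f] of [U_n] up to [q = r (G)].

   Lower bound: let [rho k = f P_k / f P_(k-1)], so [rho (k+1) = 1 - q / rho k].
   If [f] is positive on all induced subgraphs, [f T <= rho |T| * f (T - v)] for every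
   vertex [v] of a tree [T]: joining trees by an edge reduces this to
   [rho a * rho b <= rho (a + b)] when [q < rho a * rho b], which follows from an
   addition formula for [rho]. A similar estimate for the deletion of two vertices,
   applied to the two neighbours of a vertex of the cycle of [G], gives
   [rho (n-2) > 2 q], which says that [f C_n > 0]; thus [r (G) <= r (C_n)]. *)

(** * Independence sums over vertex subsets *)

(** A value over an arbitrary ring, because it is taken in the reals, in the complex numbers and at
    [- 'X] in [{poly R}]. Induced subgraphs are vertex subsets, so deletions never change the
    type. *)
Definition indep_sum (K : nzRingType) (T : finType) (e : rel T) (S : {set T})
    (x : K) : K :=
  \sum_(I : {set T} | independent e I && (I \subset S)) x ^+ #|I|.

Definition nbhs_of (T : finType) (e : rel T) (v : T) : {set T} :=
  [set w | e v w].

Section IndepSum.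
Variables (K : comNzRingType) (T : finType) (e : rel T).
Hypotheses (e_sym : symmetric e) (e_irr : irreflexive e).
Implicit Types (S A B I : {set T}) (u v : T).

Lemma independentP I : reflect {in I &, forall x y, ~~ e x y} (independent e I).
Proof.
apply: (iffP forall_inP) => [h u v uI vI|h u uI].
  by move/forall_inP: (h u uI); apply.
by apply/forall_inP => v; apply: h.
Qed.

Lemma independent_setU1 v I : v \notin I ->
  independent e (v |: I) = independent e I && [disjoint I & nbhs_of e v].
Proof.
move=> vI; apply/independentP/andP => [h|[/independentP h /pred0P d] u w].
  split; first by apply/independentP => u w uI wI; apply: h; rewrite inE ?uI ?wI orbT.
  apply/pred0P => u /=; rewrite !inE; apply/negbTE/negP => /andP[uI].
  by apply/negP/h; rewrite !inE ?uI ?eqxx ?orbT.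
have d' y : y \in I -> ~~ e v y.
  by move=> yI; have := d y; rewrite /= !inE yI /= => ->.
rewrite !inE => /orP[/eqP->|uI] /orP[/eqP->|wI]; rewrite ?e_irr ?d' //.
  by rewrite e_sym d'.
exact: h.
Qed.

Lemma indep_sum0 (x : K) : indep_sum e set0 x = 1.
Proof.
rewrite /indep_sum (big_pred1 set0) ?cards0 // => I /=.
rewrite subset0; case: eqP => [->|_]; last by rewrite andbF.
by rewrite andbT; apply/independentP => u v; rewrite inE.
Qed.

Lemma indep_sumD1 S v (x : K) : v \in S ->
  indep_sum e S x =
  indep_sum e (S :\ v) x + x * indep_sum e (S :\ v :\: nbhs_of e v) x.
Proof.
move=> vS; rewrite /indep_sum (bigID (fun I => v \in I)) /= addrC; congr +%R.
  apply: eq_bigl => I; rewrite subsetD1 andbA //.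
rewrite mulr_sumr (reindex_onto (fun I => v |: I) (fun I => I :\ v)) /=; last first.
  by move=> I /andP[_ vI]; rewrite setD1K.
apply: eq_big => [I|I /andP[_ /eqP <-]]; last first.
  by rewrite -exprS; congr (_ ^+ _); rewrite cardsU1 !inE eqxx.
rewrite !inE eqxx /= andbT subUset sub1set vS /=.
case vI: (v \in I).
  have -> : ((v |: I) :\ v == I) = false.
    by apply/negbTE; apply: contraTneq vI => <-; rewrite !inE eqxx.
  by rewrite subsetD subsetD1 vI !andbF.
rewrite setU1K ?vI // eqxx andbT independent_setU1 ?vI //.
rewrite subsetD subsetD1 vI andbT -!andbA; congr andb; exact: andbC.
Qed.
End IndepSum.

Section IndepSumJoin.
Variables (K : comNzRingType) (T : finType) (e : rel T).
Hypotheses (e_sym : symmetric e) (e_irr : irreflexive e).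
Implicit Types (S A B I : {set T}) (u v : T).

(** Deleting a vertex of [A] and its neighbours leaves [B] untouched, so the deletion recurrence and
    induction on the size of [A] give the product. *)
Lemma indep_sum_disconnected A B (x : K) : [disjoint A & B] ->
    (forall u v, u \in A -> v \in B -> ~~ e u v) ->
  indep_sum e (A :|: B) x = indep_sum e A x * indep_sum e B x.
Proof.
have [n] := ubnP #|A|; elim: n A => // n IHn A An dAB eAB.
have [->|[v vA]] := set_0Vmem A; first by rewrite set0U indep_sum0 mul1r.
have vB : v \notin B by rewrite (disjointFr dAB).
have split_at (C : {set T}) : C \subset A :\ v ->
    indep_sum e (C :|: B) x = indep_sum e C x * indep_sum e B x.
  move=> CA; have CsubA := subset_trans CA (subD1set A v).
  apply: IHn; last by move=> u w /(subsetP CsubA); exact: eAB.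
    rewrite (leq_ltn_trans (subset_leq_card CA)) // -ltnS (leq_trans _ An) //.
    by rewrite ltnS (cardsD1 v A) vA.
  exact: disjointWl CsubA dAB.
have vAB : v \in A :|: B by rewrite inE vA.
rewrite (indep_sumD1 e_sym e_irr _ vAB) (indep_sumD1 e_sym e_irr _ vA).
have -> : (A :|: B) :\ v = A :\ v :|: B.
  by apply/setP => u; rewrite !inE; case: eqP => //= ->; rewrite (negbTE vB).
have -> : (A :\ v :|: B) :\: nbhs_of e v = (A :\ v :\: nbhs_of e v) :|: B.
  apply/setP => u; rewrite !inE; case uB: (u \in B); last by rewrite !orbF.
  by rewrite !orbT andbT eAB.
by rewrite !split_at ?subsetDl // mulrDl mulrA.
Qed.

Lemma indep_sum_joinD1 A B a (x : K) : a \in A -> [disjoint A & B] ->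
    (forall u v, u \in A -> v \in B -> e u v -> u = a) ->
  indep_sum e ((A :|: B) :\ a) x = indep_sum e (A :\ a) x * indep_sum e B x.
Proof.
move=> aA dAB eAB; have aB : a \notin B by rewrite (disjointFr dAB).
rewrite setDUl (_ : B :\ a = B); last by apply/setDidPl; rewrite disjoint_sym disjoints1.
apply: indep_sum_disconnected; first exact: disjointWl (subD1set _ _) dAB.
by move=> u v /setD1P[ua uA] vB; apply: contra ua => /(eAB u v uA vB) ->.
Qed.

(* The edges between [A] and [B] all leave from [a]: delete [a]. *)
Lemma indep_sum_join A B a (x : K) : a \in A -> [disjoint A & B] ->
    (forall u v, u \in A -> v \in B -> e u v -> u = a) ->
  indep_sum e (A :|: B) x =
  indep_sum e (A :\ a) x * indep_sum e B x +
  (indep_sum e A x - indep_sum e (A :\ a) x) * indep_sum e (B :\: nbhs_of e a) x.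
Proof.
move=> aA dAB eAB; have aAB : a \in A :|: B by rewrite inE aA.
rewrite (indep_sumD1 e_sym e_irr _ aAB) indep_sum_joinD1 //; congr (_ + _).
rewrite (indep_sumD1 e_sym e_irr _ aA) addrAC subrr add0r -mulrA; congr (_ * _).
have aB : a \notin B by rewrite (disjointFr dAB).
have -> : (A :|: B) :\ a = A :\ a :|: B.
  by apply/setP => u; rewrite !inE; case: eqP => //= ->; rewrite (negbTE aB).
rewrite setDUl; apply: indep_sum_disconnected.
  apply: disjointWl (subset_trans (subsetDl _ _) (subD1set _ _)) _.
  exact: disjointWr (subsetDl _ _) dAB.
move=> u v /setDP[/setD1P[ua uA] _] /setDP[vB _].
by apply: contra ua => /(eAB u v uA vB) ->.
Qed.

Lemma horner_indep_poly (x : K) : (indep_poly K e).[x] = indep_sum e setT x.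
Proof.
rewrite horner_poly /indep_sum.
rewrite (partition_big (fun I : {set T} => inord #|I| : 'I_(#|T|.+1)) xpredT) //=.
apply: eq_bigr => k _; rewrite /num_independent.
rewrite (eq_bigr (fun _ => x ^+ k)); last first.
  by move=> I /andP[_ /eqP <-]; rewrite inordK // ltnS max_card.
rewrite sumr_const mulr_natl; congr (_ *+ _).
apply: eq_card => I; rewrite !inE unfold_in /= subsetT andbT; congr andb.
by rewrite -val_eqE /= inordK // ltnS max_card.
Qed.
End IndepSumJoin.

Lemma indep_sum_rmorph (K L : comNzRingType) (phi : {rmorphism K -> L})
    (T : finType) (e : rel T) (S : {set T}) (x : K) :
  phi (indep_sum e S x) = indep_sum e S (phi x).
Proof. by rewrite rmorph_sum; apply: eq_bigr => I _; rewrite rmorphXn. Qed.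

(** * Non-vanishing in a complex disc *)

Section Shearer.
Variables (T : finType) (e : rel T).
Hypotheses (e_sym : symmetric e) (e_irr : irreflexive e).
Implicit Types (S A B I : {set T}) (u v : T).

(* Shearer's argument: the ratio bound propagates from [B :\ v] to [B]. *)
Lemma indep_sum_norm_ratio (K : numDomainType) (z : K) A B :
    (forall S, 0 < indep_sum e S (- `|z|)) -> A \subset B ->
  `|indep_sum e A z| * indep_sum e B (- `|z|) <=
  `|indep_sum e B z| * indep_sum e A (- `|z|).
Proof.
move=> pos; have [n] := ubnP #|B|; elim: n A B => // n IHn A B Bn AB.
have [->//|neqAB] := eqVneq A B.
have /subsetPn[v vB vA] : ~~ (B \subset A) by rewrite eqEsubset AB in neqAB.
have AB' : A \subset B :\ v by rewrite subsetD1 AB.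
have B'n : (#|B :\ v| < n)%N by rewrite -ltnS (leq_trans _ Bn) // ltnS (cardsD1 v B) vB.
have step : `|indep_sum e (B :\ v) z| * indep_sum e B (- `|z|) <=
            `|indep_sum e B z| * indep_sum e (B :\ v) (- `|z|).
  rewrite !(indep_sumD1 e_sym e_irr _ vB).
  have := IHn _ _ B'n (subsetDl (B :\ v) (nbhs_of e v)).
  have := pos (B :\ v); have := pos (B :\ v :\: nbhs_of e v).
  set F := indep_sum e (B :\ v) z; set F' := indep_sum e _ z.
  set f := indep_sum e (B :\ v) _; set f' := indep_sum e _ _.
  move=> f'0 f0 h.
  have tri : `|F| - `|z| * `|F'| <= `|F + z * F'|.
    by rewrite -normrM -[`|z * F'|]normrN -{1}[F](addrK (z * F')) lerBlDr ler_normD.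
  apply: le_trans (ler_wpM2r (ltW f0) tri).
  by rewrite mulrDr mulrBl mulNr mulrN lerD2l lerN2 mulrCA -!mulrA ler_wpM2l.
have := IHn _ _ B'n AB'.
move: step (pos (B :\ v)) (pos A) (pos B).
set a := `|indep_sum e A z|; set b := `|indep_sum e B z|; set c := `|_|.
move=> h1 p1 p2 p3 h2.
rewrite -(ler_pM2r p1).
apply: (@le_trans _ _ (c * indep_sum e A (- `|z|) * indep_sum e B (- `|z|))).
  by rewrite mulrAC ler_pM2r.
by rewrite mulrAC [leRHS]mulrAC ler_pM2r.
Qed.

(** The ratio bound against the empty set, whose sum is 1, puts the positive value at minus the
    modulus of [z] below the modulus of the value at [z]. *)
Lemma indep_sum_neq0 (K : numDomainType) (z : K) S :
  (forall S, 0 < indep_sum e S (- `|z|)) -> indep_sum e S z != 0.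
Proof.
move=> pos; rewrite -normr_gt0.
have := indep_sum_norm_ratio pos (sub0set S).
by rewrite !indep_sum0 normr1 mul1r mulr1; apply: lt_le_trans.
Qed.
End Shearer.

(** * The smallest positive zero *)

Lemma poly_first_root (R : rcfType) (p : {poly R}) (b : R) :
    0 < p.[0] -> 0 <= b -> p.[b] <= 0 ->
  exists r, [/\ 0 < r, r <= b, p.[r] = 0 & forall x, 0 <= x < r -> 0 < p.[x]].
Proof.
move=> p0 b0 pb.
have root_below x : 0 <= x -> p.[x] <= 0 -> exists2 y, 0 < y <= x & root p y.
  move=> x0 px; have [|y /itvP y_in py] := @polyrcf.poly_ivt _ p 0 x x0.
    by rewrite pmulr_rle0.
  exists y => //; rewrite y_in andbT lt_def y_in andbT.
  by apply: contraTneq p0 => y0; rewrite y0 in py; rewrite (rootP py) ltxx.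
have pn0 : p != 0 by apply: contraTneq p0 => ->; rewrite horner0 ltxx.
have [c /andP[c0 cb] pc] := root_below b b0 pb.
(* The interval ends at [b + 1] so that the root [c], which may equal [b], is interior. *)
have b1 : 0 < b + 1 by rewrite ltr_wpDl.
have c_in : c \in `]0, b + 1[ by rewrite in_itv /= c0 (le_lt_trans cb) // ltrDl.
have : exists r, [/\ 0 < r, p.[r] = 0 & {in `]0, r[, forall z, ~~ root p z}].
  case: (next_rootP p 0 (b + 1)) => [pE|y _ py /itvP y_in no_root|d _ _ no_root].
  - by rewrite pE eqxx in pn0.
  - by exists y; rewrite y_in.
  - by have := no_root _ c_in; rewrite pc.
case=> r [r0 pr no_root]; exists r; split => //.
  rewrite (le_trans _ cb) // leNgt; apply/negP => cr.
  by have := no_root c; rewrite in_itv /= c0 cr pc => /(_ isT).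
move=> x /andP[x0 xr]; rewrite ltNge; apply/negP => /(root_below x x0)[y /andP[y0 yx]].
by apply/negP/no_root; rewrite in_itv /= y0 (le_lt_trans yx).
Qed.

Section ShearerRadius.
Variables (R : realType) (T : finType) (e : rel T).
Hypotheses (e_sym : symmetric e) (e_irr : irreflexive e).
Implicit Types (S A B I : {set T}) (u v : T).

(** Positivity is asked of all induced subgraphs, as Shearer's argument requires; the last clause
    keeps the weaker sign at the endpoint [r]. *)
Definition shearer_radius S (r : R) : Prop :=
  [/\ 0 < r, indep_sum e S (- r) = 0,
      forall q A, 0 <= q < r -> A \subset S -> 0 < indep_sum e A (- q)
    & forall A, A \subset S -> 0 <= indep_sum e A (- r)].

Lemma horner_indep_sum S (q : R) :
  (indep_sum e S (- 'X : {poly R})).[q] = indep_sum e S (- q).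
Proof.
have := indep_sum_rmorph (horner_eval q) e S (- 'X).
by rewrite /= !horner_evalE hornerN hornerX.
Qed.

Lemma indep_sum_gt0 S (x : R) : 0 <= x -> 0 < indep_sum e S x.
Proof.
move=> x0; rewrite /indep_sum (bigD1 set0) /=; last first.
  by rewrite sub0set andbT; apply/independentP => u v; rewrite inE.
by rewrite cards0 expr0 ltr_pwDl // sumr_ge0 // => I _; rewrite exprn_ge0.
Qed.

(** At the radius of [S :\ v] the recurrence for [S] leaves only a nonpositive term, so the first
    zero for [S] is at most each of these radii. The sign conditions then pass up, since a proper
    subset of [S] lies in some [S :\ w]. When [S :\ v] is empty, 1 replaces its radius. *)
Lemma shearer_radius_exists S : S != set0 -> exists r, shearer_radius S r.
Proof.
have [n] := ubnP #|S|; elim: n S => // n IHn S Sn Sn0.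
have radius_le v : v \in S ->
  exists2 r : R, 0 <= r & [/\ indep_sum e S (- r) <= 0,
    forall q A, 0 <= q < r -> A \subset S :\ v -> 0 < indep_sum e A (- q)
    & forall A, A \subset S :\ v -> 0 <= indep_sum e A (- r)].
  move=> vS; have [S'0|S'n0] := eqVneq (S :\ v) set0.
    exists 1 => //; split => [|q A _|A]; last 2 first.
    - by rewrite S'0 subset0 => /eqP ->; rewrite indep_sum0.
    - by rewrite S'0 subset0 => /eqP ->; rewrite indep_sum0.
    by rewrite (indep_sumD1 e_sym e_irr _ vS) S'0 set0D !indep_sum0 mulr1 subrr.
  have S'n : (#|S :\ v| < n)%N by rewrite -ltnS (leq_trans _ Sn) // ltnS (cardsD1 v S) vS.
  have [r [r0 fr pos nneg]] := IHn _ S'n S'n0.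
  exists r; first exact: ltW.
  split => //; rewrite (indep_sumD1 e_sym e_irr _ vS) fr add0r mulNr oppr_le0.
  by rewrite mulr_ge0 ?(ltW r0) ?nneg ?subsetDl.
have [v vS] := set0Pn _ Sn0; have [b b0 [fb _ _]] := radius_le v vS.
have [||r [r0 _ fr pos]] := @poly_first_root _ (indep_sum e S (- 'X : {poly R})) b _ b0.
- by rewrite horner_indep_sum oppr0 indep_sum_gt0.
- by rewrite horner_indep_sum.
rewrite horner_indep_sum in fr.
have proper A : A \subset S -> A != S -> exists2 w, w \in S & A \subset S :\ w.
  move=> AS neq; have /subsetPn[w wS wA] : ~~ (S \subset A).
    by rewrite eqEsubset AS in neq.
  by exists w => //; rewrite subsetD1 AS.
have r_min c : 0 <= c -> indep_sum e S (- c) <= 0 -> r <= c.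
  move=> c0 fc; rewrite leNgt; apply/negP => cr.
  by have := pos c; rewrite c0 cr horner_indep_sum => /(_ isT); rewrite ltNge fc.
exists r; split => // [q A /andP[q0 qr] AS|A AS].
  have [->|neq] := eqVneq A S; first by rewrite -horner_indep_sum pos ?q0.
  have [w wS Aw] := proper A AS neq; have [c c0 [fc posc _]] := radius_le w wS.
  by apply: posc Aw; rewrite q0 (lt_le_trans qr) ?r_min.
have [->|neq] := eqVneq A S; first by rewrite fr.
have [w wS Aw] := proper A AS neq; have [c c0 [fc posc nnegc]] := radius_le w wS.
have := r_min c c0 fc; rewrite le_eqVlt => /predU1P[->|rc]; first exact: nnegc.
by apply/ltW/posc; rewrite ?(ltW r0).
Qed.

(** A complex root nearer to 0 than [- r] would contradict [indep_sum_neq0]. Any real root of least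
    modulus then has modulus [r], and it is negative because the sum is positive at nonnegative
    reals. *)
Lemma xi_shearer_radius : (0 < #|T|)%N -> shearer_radius setT (- xi R e).
Proof.
rewrite -cardsT card_gt0 => T_n0.
have [r rP] := shearer_radius_exists T_n0; have [r0 fr pos nneg] := rP.
have rootE (x : R) : root (indep_poly _ e) (x%:C)%C = (indep_sum e setT x == 0).
  by rewrite rootE horner_indep_poly -(indep_sum_rmorph (real_complex R)) fmorph_eq0.
have r_root : smallest_modulus_root e (- r).
  split=> [|z]; first by rewrite rootE fr.
  rewrite /root horner_indep_poly => fz.
  rewrite (_ : `|(- r)%:C%C| = r%:C%C :> R[i]); last first.
    by rewrite rmorphN normrN ger0_norm // lecR ltW.
  have [q qE] : exists q : R, `|z| = q%:C%C by apply/complex_realP; exact: normr_real.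
  rewrite qE lecR leNgt; apply/negP => qr; move: fz; apply/negP.
  apply: (indep_sum_neq0 e_sym e_irr) => S; rewrite qE -rmorphN.
  rewrite -(indep_sum_rmorph (real_complex R)) ltcR pos ?subsetT // qr andbT.
  by rewrite -lecR -qE normr_ge0.
have [x_root x_min] : smallest_modulus_root e (xi R e) := classical_sets.xgetI 0 r_root.
set x := xi R e in x_root x_min *.
have normE (y : R) : `|y%:C%C| = `|y|%:C%C :> R[i].
  by have := normc_def (y%:C)%C; rewrite /= expr0n addr0 sqrtr_sqr.
suff -> : - x = r by [].
have nx : `|x| = r.
  apply/eqP; rewrite eq_le; case: r_root => nr_root nr_min.
  have := x_min _ nr_root; rewrite !normE lecR normrN (gtr0_norm r0) => ->.
  by have := nr_min _ x_root; rewrite !normE lecR normrN (gtr0_norm r0).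
have [x0|x0] := leP 0 x; last by rewrite -nx ltr0_norm.
by move: x_root; rewrite rootE gt_eqF // indep_sum_gt0.
Qed.
End ShearerRadius.

(** * The ratio sequence of paths *)

(* [rho q k] is the ratio of the independence polynomials of the paths on [k] and
   [k.-1] vertices at [- q]. *)
Definition rho (R : fieldType) (q : R) (k : nat) : R :=
  iter k (fun x => 1 - q / x) 1.

Arguments rho : simpl never.

Section Rho.
Variables (R : realFieldType) (q : R).
Hypothesis q_gt0 : 0 < q.
Local Notation rho := (rho q).
Local Notation rho_pos n := (forall j : nat, (j <= n)%N -> 0 < rho j).

Lemma rhoS k : rho k.+1 = 1 - q / rho k.
Proof. by []. Qed.

Lemma rho_decr k : rho_pos k -> rho k.+1 <= rho k.
Proof.
elim: k => [|k IHk] pos; first by rewrite /rho /= divr1 gerBl ltW.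
rewrite [in leRHS]rhoS rhoS lerD2l lerN2 ler_pM2l //.
have p1 := pos k.+1 (leqnn _); have p0 := pos k (leqnSn _).
by rewrite lef_pV2 ?posrE // IHk // => j jk; apply: pos; rewrite leqW.
Qed.

Lemma rho_le1 k : rho_pos k -> rho k <= 1.
Proof.
elim: k => [//|k IHk] pos.
have pos' : rho_pos k by move=> j jk; apply: pos; rewrite leqW.
exact: le_trans (rho_decr pos') (IHk pos').
Qed.

Lemma rho_le1B k : (0 < k)%N -> rho_pos k -> rho k <= 1 - q.
Proof.
case: k => // k _ pos.
have pos' : rho_pos k by move=> j jk; apply: pos; rewrite leqW.
rewrite rhoS lerD2l lerN2 ler_pdivlMr ?pos' //.
by rewrite ler_piMr ?(ltW q_gt0) ?rho_le1.
Qed.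

(** An addition law for the iterates of the Moebius map [x => 1 - q / x]; the form without division
    asks nothing of the factor on the left. *)
Lemma rho_add a b : (forall i, (i < b)%N -> rho i != 0 /\ rho (a + i)%N != 0) ->
  rho (a + b)%N * (q - (1 - rho a) * (1 - rho b)) = q * (rho a + rho b - 1).
Proof.
elim: b => [|b IHb] n0; first by rewrite addn0 /rho /=; ring.
have [y0 z0] := n0 b (ltnSn b).
have := IHb (fun i ib => n0 i (leqW ib)).
rewrite addnS !rhoS; move: y0 z0.
move: (rho a) (rho b) (rho (a + b)%N) => x y z y0 z0 h.
apply: (mulfI y0); apply: (mulfI z0).
transitivity (q * (z - q) * (x + y - 1)); first by field; rewrite y0 z0.
transitivity (q * (z * (x * y - q))); last by field; rewrite y0.
have -> : q * (z - q) * (x + y - 1) =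
    q * z * (x + y - 1) - q * (q * (x + y - 1)) by ring.
by rewrite -h; ring.
Qed.

(** Since [1 - rho k.+1 = q / rho k], for positive indices the product is the square of [q] over a
    product of two earlier values, which is no smaller than [rho a * rho b]. This makes the factor
    in [rho_add] positive. *)
Lemma rho_gap a b : rho_pos a -> rho_pos b -> q < rho a * rho b ->
  (1 - rho a) * (1 - rho b) < q.
Proof.
case: a => [|a] pa; first by rewrite /rho /= subrr mul0r.
case: b => [|b] pb; first by rewrite {2}/rho /= subrr mulr0.
move=> h; have pa' : rho_pos a by move=> j ja; apply: pa; rewrite leqW.
have pb' : rho_pos b by move=> j ja; apply: pb; rewrite leqW.
have h' : q < rho a * rho b.
  apply: lt_le_trans h _; apply: ler_pM; rewrite ?rho_decr //; apply: ltW.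
    exact: pa.
  exact: pb.
have xa := pa' _ (leqnn a); have xb := pb' _ (leqnn b).
rewrite !rhoS !subKr mulf_div ltr_pdivrMr ?mulr_gt0 //.
by rewrite ltr_pM2l.
Qed.

(** With [x = rho a] and [y = rho b], the difference of the two sides times the positive factor of
    [rho_add] is [(1 - x) * (1 - y) * (x * y - q)]. Induction on [b] supplies the nonzero values
    that [rho_add] needs. *)
Lemma rho_supermult a b : rho_pos a -> rho_pos b -> q < rho a * rho b ->
  rho_pos (a + b)%N /\ rho a * rho b <= rho (a + b)%N.
Proof.
move=> pa; elim: b => [|b IHb] pb h; first by rewrite addn0 /rho /= mulr1.
have pb' : rho_pos b by move=> j ja; apply: pb; rewrite leqW.
have xa := pa _ (leqnn a); have xb := pb _ (leqnn b.+1).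
have [|pab _] := IHb pb'.
  by apply: lt_le_trans h _; rewrite ler_pM2l ?rho_decr.
have le_ab : rho a * rho b.+1 <= rho (a + b.+1)%N.
  have gap := rho_gap pa pb h.
  rewrite -(@ler_pM2r _ (q - (1 - rho a) * (1 - rho b.+1))) ?subr_gt0 //.
  rewrite rho_add; last first.
    move=> i ib; split; rewrite gt_eqF //; [apply: pb' | apply: pab] => //.
    by rewrite leq_add2l.
  have a1 := rho_le1 pa; have b1 := rho_le1 pb.
  set x := rho a in a1 h *; set y := rho b.+1 in b1 h *.
  have : 0 <= (1 - x) * (1 - y) * (x * y - q).
    by rewrite mulr_ge0 ?mulr_ge0 ?subr_ge0 // ltW.
  by rewrite -subr_ge0; congr (0 <= _); ring.
split=> // j; rewrite addnS leq_eqVlt ltnS => /predU1P[->|]; last exact: pab.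
by rewrite -addnS (lt_le_trans _ le_ab) // (lt_trans q_gt0).
Qed.

(** For [n = a + b], the bound [rho n - q] is [rho n * rho n.+1], the ratio for a path on [n.+1]
    vertices that loses both ends. *)
Lemma rho_pair a b : (0 < a)%N -> rho_pos a -> rho_pos b -> q < rho a * rho b ->
  rho a + rho b.+1 - 1 <= rho (a + b)%N - q.
Proof.
move=> a0 pa pb h; have gap := rho_gap pa pb h.
have [pab _] := rho_supermult pa pb h.
have y0 := pb b (leqnn b); have x1 := rho_le1B a0 pa; have y1 := rho_le1 pb.
have : rho (a + b)%N * (q - (1 - rho a) * (1 - rho b)) = q * (rho a + rho b - 1).
  apply: rho_add => i ib; split; rewrite gt_eqF //; [apply: pb | apply: pab].
    exact: ltnW.
  by rewrite leq_add2l ltnW.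
rewrite rhoS; move: gap h y0 x1 y1.
move: (rho a) (rho b) (rho (a + b)%N) => x y z gap h y0 x1 y1 zE.
rewrite -(@ler_pM2r _ (q - (1 - x) * (1 - y))) ?subr_gt0 // (mulrBl _ z) zE.
rewrite -(ler_pM2l y0).
(* What remains after clearing denominators; [1 - x - q] is nonnegative because [a] is positive. *)
have : 0 <= (1 - y) * ((1 - x - q) * (x * y - q)).
  by rewrite !mulr_ge0 ?subr_ge0 ?(ltW h) //; lra.
by rewrite -subr_ge0; congr (0 <= _); field; rewrite gt_eqF.
Qed.

(** The product [(rho a - q) * rho b] is at most [rho (a + b) - q], so [q] below the former gives
    [q *+ 2] below [rho (a + b)]. *)
Lemma rho_cycle a b : (0 < a)%N -> rho_pos a -> rho_pos b ->
    q < (rho a - q) * rho b ->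
  rho_pos (a + b)%N /\ q *+ 2 < rho (a + b)%N.
Proof.
move=> a0 pa pb h; have y0 := pb b (leqnn b).
have h' : q < rho a * rho b.
  by apply: lt_trans h _; rewrite ltr_pM2r // gtrBl.
have gap := rho_gap pa pb h'; have [pab _] := rho_supermult pa pb h'.
split=> //; have x1 := rho_le1B a0 pa; have y1 := rho_le1 pb.
have : rho (a + b)%N * (q - (1 - rho a) * (1 - rho b)) = q * (rho a + rho b - 1).
  apply: rho_add => i ib; split; rewrite gt_eqF //; [apply: pb | apply: pab].
    exact: ltnW.
  by rewrite leq_add2l ltnW.
move: h h' gap y0 x1 y1.
set x := rho a; set y := rho b; set z := rho (a + b)%N => h h' gap y0 x1 y1 zE.
suff : (x - q) * y <= z - q by rewrite mulr2n -ltrBrDr; apply: lt_le_trans.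
rewrite -(@ler_pM2r _ (q - (1 - x) * (1 - y))) ?subr_gt0 // (mulrBl _ z) zE.
have : 0 <= (1 - y) * ((1 - x - q) * ((x - q) * y) + q * ((x - q) * y - q)).
  rewrite mulr_ge0 ?subr_ge0 // addr_ge0 // mulr_ge0 ?subr_ge0 ?(ltW q_gt0) ?(ltW h) //.
    lra.
  by rewrite ltW // (lt_trans q_gt0).
by rewrite -subr_ge0; congr (0 <= _); ring.
Qed.
End Rho.

(** * Trees and graphs with one cycle *)

Definition leaf_at (T : finType) (e : rel T) (S : {set T}) (u w : T) : Prop :=
  [/\ u \notin S, w \in S & forall x, x \in S -> e u x = (x == w)].

(** The base is a parameter: a single vertex yields trees, and a cycle yields connected unicyclic
    graphs. *)
Inductive grown (T : finType) (e : rel T) (S0 : {set T}) : {set T} -> Prop :=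
| GrownBase : grown e S0 S0
| GrownLeaf S u w : grown e S0 S -> leaf_at e S u w -> grown e S0 (u |: S).

Definition tree (T : finType) (e : rel T) (S : {set T}) : Prop :=
  exists v, grown e [set v] S.

Definition joined (T : finType) (e : rel T) (A B : {set T}) (v : T)
    (U : {set T}) : Prop :=
  [/\ v \in A, U \subset B, [disjoint A & B]
    & forall x y, x \in A -> y \in B -> e x y = (x == v) && (y \in U)].

Inductive rooted_tree (T : finType) (e : rel T) : T -> {set T} -> Prop :=
| RootedVertex v : rooted_tree e v [set v]
| RootedJoin v u A B : rooted_tree e v A -> rooted_tree e u B ->
    joined e A B v [set u] -> rooted_tree e v (A :|: B).

Section Trees.
Variables (T : finType) (e : rel T).
Hypotheses (e_sym : symmetric e) (e_irr : irreflexive e).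
Implicit Types (S A B U : {set T}) (u v w : T).

Lemma disjoint_setU1 u A B :
  [disjoint u |: A & B] = (u \notin B) && [disjoint A & B].
Proof. by rewrite -!setI_eq0 setIUl setU_eq0 !setI_eq0 disjoints1. Qed.

Lemma rooted_tree_root v S : rooted_tree e v S -> v \in S.
Proof. by elim=> [u|u w A B _ uA _ _ _]; rewrite ?set11 // inE uA. Qed.

Lemma joined_leafl A B v U u w : joined e A B v U -> leaf_at e (A :|: B) u w ->
  w \in A -> joined e (u |: A) B v U.
Proof.
move=> [vA UB dAB eAB] [uAB wAB eu] wA.
move: uAB; rewrite inE negb_or => /andP[uA uB].
split=> //; first by rewrite inE vA orbT.
  by rewrite disjoint_setU1 uB.
move=> x y; rewrite inE => /orP[/set1P ->|xA] yB; last exact: eAB.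
rewrite eu ?inE ?yB ?orbT // (_ : (u == v) = false).
  by apply: contraTF yB => /eqP ->; rewrite (disjointFr dAB).
by apply: contraNF uA => /eqP ->.
Qed.

Lemma joined_leafr A B v U u w : joined e A B v U -> leaf_at e (A :|: B) u w ->
  w \in B -> joined e A (u |: B) v U.
Proof.
move=> [vA UB dAB eAB] [uAB wAB eu] wB.
move: uAB; rewrite inE negb_or => /andP[uA uB].
split=> //; first by rewrite (subset_trans UB) ?subsetUr.
  by rewrite disjoint_sym disjoint_setU1 uA disjoint_sym.
move=> x y xA; rewrite inE => /orP[/set1P ->|yB]; last exact: eAB.
rewrite e_sym eu ?inE ?xA // (_ : (u \in U) = false) ?andbF.
  by apply: contraTF xA => /eqP ->; rewrite (disjointFl dAB).
by apply: contraNF uB => /(subsetP UB).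
Qed.

Lemma leaf_joined S u w : leaf_at e S u w -> joined e [set u] S u [set w].
Proof.
move=> [uS wS eu]; split; rewrite ?set11 ?sub1set ?disjoints1 //.
by move=> x y /set1P -> yS; rewrite eqxx inE eu.
Qed.

Lemma leaf_subl A B u w : leaf_at e (A :|: B) u w -> w \in A -> leaf_at e A u w.
Proof.
move=> [uAB _ eu] wA; split=> //.
  by apply: contra uAB => uA; rewrite inE uA.
by move=> x xA; rewrite eu // inE xA.
Qed.

Lemma leaf_subr A B u w : leaf_at e (A :|: B) u w -> w \in B -> leaf_at e B u w.
Proof. by rewrite setUC; apply: leaf_subl. Qed.

Lemma rooted_tree_leaf v S u w :
  rooted_tree e v S -> leaf_at e S u w -> rooted_tree e v (u |: S).
Proof.
move=> tS; elim: tS u w => {v S} [v|v z A B tA IHA tB IHB jAB] u w lf.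
  have [uv /set1P wv eu] := lf; rewrite wv in eu.
  rewrite setUC; apply: RootedJoin; [exact: RootedVertex|exact: RootedVertex|].
  split; rewrite ?set11 ?sub1set ?disjoints1 ?set11 //; first by rewrite inE eq_sym -in_set1.
  move=> x y /set1P -> /set1P ->.
  by rewrite !eqxx set11 e_sym eu ?eqxx ?set11.
have [_ wAB _] := lf; move: wAB; rewrite inE => /orP[wA|wB].
  rewrite setUA; apply: RootedJoin tB (joined_leafl jAB lf wA).
  by apply: IHA (leaf_subl lf wA).
rewrite setUCA; apply: RootedJoin tA _ (joined_leafr jAB lf wB).
exact: IHB (leaf_subr lf wB).
Qed.

(** When the root is the newest leaf, the rest of the tree hangs from it by a single edge; otherwise
    the leaf is inserted into the branch of its neighbour. *)
Lemma tree_rooted S v : tree e S -> v \in S -> rooted_tree e v S.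
Proof.
case=> v0 gS; elim: gS v => {S} [|S u w _ IHS lf] v.
  by move=> /set1P ->; apply: RootedVertex.
rewrite inE => /orP[/set1P ->|vS]; last exact: rooted_tree_leaf (IHS _ vS) lf.
have [_ wS _] := lf.
exact: RootedJoin (RootedVertex e u) (IHS _ wS) (leaf_joined lf).
Qed.

Lemma tree_leaf S u w : tree e S -> leaf_at e S u w -> tree e (u |: S).
Proof. by case=> v gS lf; exists v; apply: GrownLeaf gS lf. Qed.

(** The cut is at the first edge of the path from [a] to [b], so that [a] is the root of its
    side. *)
Lemma tree_split S a b : tree e S -> a \in S -> b \in S -> a != b ->
  exists A B a', [/\ S = A :|: B, rooted_tree e a A, tree e B, b \in B
    & joined e A B a [set a']].
Proof.
case=> v0 gS; elim: gS a b => {S} [|S u w gS IHS lf] a b.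
  by move=> /set1P -> /set1P ->; rewrite eqxx.
have tS : tree e S by exists v0.
have [uS wS eu] := lf.
rewrite !inE => /predU1P[->|aS] /predU1P[->|bS] ab.
- by rewrite eqxx in ab.
- by exists [set u], S, w; split=> //; [exact: RootedVertex|exact: leaf_joined].
(* The new leaf is [b], so the path from [a] ends through [w]: either [w] is [a] and the leaf alone
   is cut off, or the cut between [a] and [w] serves. *)
- have [wa|wa] := eqVneq w a.
    exists S, [set u], u; split; rewrite ?set11 //; first by rewrite setUC.
    + exact: tree_rooted.
    + by exists u; apply: GrownBase.
    split; rewrite ?set11 // 1?disjoint_sym ?disjoints1 //.
    by move=> x y xS /set1P ->; rewrite set11 andbT e_sym eu // wa.
  rewrite eq_sym in wa.
  have [A [B [a' [SE tA tB wB jAB]]]] := IHS _ _ aS wS wa.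
  rewrite SE in lf *; exists A, (u |: B), a'; split=> //.
  + by rewrite setUCA.
  + exact: tree_leaf tB (leaf_subr lf wB).
  + by rewrite setU11.
  + exact: joined_leafr jAB lf wB.
- have [A [B [a' [SE tA tB bB jAB]]]] := IHS _ _ aS bS ab.
  rewrite SE in lf wS *; move: wS; rewrite inE => /orP[wA|wB].
    exists (u |: A), B, a'; split=> //; first by rewrite setUA.
      exact: rooted_tree_leaf tA (leaf_subl lf wA).
    exact: joined_leafl jAB lf wA.
  exists A, (u |: B), a'; split=> //; first by rewrite setUCA.
  + exact: tree_leaf tB (leaf_subr lf wB).
  + by rewrite inE bB orbT.
  + exact: joined_leafr jAB lf wB.
Qed.

(** Here [v] lies on the cycle and [a], [b] are its neighbours there; [A] is [v] with what hangs
    from it, and opening the cycle at [v] makes the rest [B] a tree. *)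
Definition cycle_split S : Prop :=
  exists v A B a b, [/\ S = A :|: B, rooted_tree e v A, tree e B, a != b
    & joined e A B v [set a; b]].

Lemma grown_cycle_split S0 S : grown e S0 S -> cycle_split S0 -> cycle_split S.
Proof.
move=> gS sp; elim: gS => {S} // S u w _ [v [A [B [a [b [SE tA tB ab jAB]]]]]] lf.
rewrite SE in lf *; have [_ wAB _] := lf; move: wAB; rewrite inE => /orP[wA|wB].
  exists v, (u |: A), B, a, b; split=> //; first by rewrite setUA.
    exact: rooted_tree_leaf tA (leaf_subl lf wA).
  exact: joined_leafl jAB lf wA.
exists v, A, (u |: B), a, b; split=> //; first by rewrite setUCA.
  exact: tree_leaf tB (leaf_subr lf wB).
exact: joined_leafr jAB lf wB.
Qed.

(** * Deletion ratios of trees compared with those of paths *)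

Section LowerBound.
Variables (K : realFieldType) (q : K).
Hypotheses (q_gt0 : 0 < q) (pos : forall S, 0 < indep_sum e S (- q)).
Local Notation f S := (indep_sum e S (- q)).
Local Notation rho := (rho q).
Local Notation rho_pos n := (forall j : nat, (j <= n)%N -> 0 < rho j).

Lemma joined_indep_sum A B v U : joined e A B v U ->
  f (A :|: B) = f (A :\ v) * f B + (f A - f (A :\ v)) * f (B :\: U).
Proof.
move=> [vA UB dAB eAB].
rewrite (indep_sum_join e_sym e_irr (- q) vA dAB); last first.
  by move=> x y xA yB; rewrite eAB // => /andP[/eqP].
congr (_ + _ * f _); apply/setP => y; rewrite !inE.
by case yB: (y \in B); rewrite ?andbF // eAB // eqxx.
Qed.

Lemma joined_indep_sumD1 A B v U : joined e A B v U ->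
  f ((A :|: B) :\ v) = f (A :\ v) * f B.
Proof.
move=> [vA UB dAB eAB]; apply: indep_sum_joinD1 => //.
by move=> x y xA yB; rewrite eAB // => /andP[/eqP].
Qed.

Lemma joined_bound A B v U k : joined e A B v U ->
    f A <= rho k.+1 * f (A :\ v) ->
  f (A :|: B) <= f (A :\ v) * (f B - q / rho k * f (B :\: U)).
Proof.
move=> jAB; rewrite (joined_indep_sum jAB) rhoS => fA.
rewrite -subr_ge0 (_ : _ - _ =
  ((1 - q / rho k) * f (A :\ v) - f A) * f (B :\: U)); last by ring.
by rewrite mulr_ge0 ?subr_ge0 // ltW.
Qed.

Lemma card_joined A B v U : joined e A B v U ->
  #|A :|: B| = (#|A|.-1 + #|B|).+1.
Proof.
case=> vA _ dAB _; rewrite cardsU disjoint_setI0 // cards0 subn0 -addSn.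
by rewrite prednK // card_gt0; apply/set0Pn; exists v.
Qed.

Lemma rooted_tree_card v S : rooted_tree e v S -> #|S| = #|S|.-1.+1.
Proof.
move=> /rooted_tree_root vS; rewrite prednK // card_gt0.
by apply/set0Pn; exists v.
Qed.

(** The arithmetic of joining by one edge: [x] is the sum over [A :|: B], [y] over [B], [z] over
    [A :\ v] and [t] over [B] without its end of the edge. The inequality [q < rho k * rho b] is
    forced by [0 < x]. *)
Lemma rooted_join_ltr k b (x y z t : K) : 0 < x -> 0 < rho k -> 0 < rho b ->
    0 < y -> x <= z * (y - q / rho k * t) -> 0 <= z -> y <= rho b * t ->
  q < rho k * rho b /\ x <= z * y * (1 - q / (rho k * rho b)).
Proof.
move=> x0 rk rb y0 xle z0 yt.
have zn0 : 0 < z.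
  by rewrite lt_def z0 andbT; apply: contraTneq xle => ->; rewrite mul0r -ltNge.
have le_t : y / rho b <= t by rewrite ler_pdivrMr // mulrC.
have xle' : x <= z * y * (1 - q / (rho k * rho b)).
  apply: le_trans xle _; rewrite -[leRHS]mulrA ler_pM2l // mulrBr mulr1 lerD2l lerN2.
  rewrite (_ : y * _ = q / rho k * (y / rho b)); last by field; rewrite !gt_eqF.
  by rewrite ler_pM2l // divr_gt0.
split=> //; have := lt_le_trans x0 xle'.
by rewrite pmulr_rgt0 ?mulr_gt0 // subr_gt0 ltr_pdivrMr ?mul1r ?mulr_gt0.
Qed.

Lemma rho_posW m n : (m <= n)%N -> rho_pos n -> rho_pos m.
Proof. by move=> mn p j jm; apply: p; apply: leq_trans jm mn. Qed.

(** Equality holds for a path rooted at an end. A join contributes the factor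
    [1 - q / (rho k * rho b)], which [rho_supermult] bounds by [rho (k + b).+1]; the sums being
    positive, so is this value of [rho]. *)
Lemma rooted_tree_rho v S : rooted_tree e v S ->
  rho_pos #|S| /\ f S <= rho #|S| * f (S :\ v).
Proof.
elim=> {v S} [v|v u A B tA [pA fA] tB [pB fB] jAB].
  have f1 : f [set v] = 1 - q.
    rewrite (indep_sumD1 e_sym e_irr _ (set11 v)) setDv set0D.
    by rewrite !indep_sum0 mulr1.
  rewrite cards1 f1 setDv indep_sum0 mulr1 /rho /= divr1; split=> //.
  have := pos [set v]; rewrite f1 => q1.
  by case=> [|[|]] //=; rewrite ?divr1 // => _; exact: ltr01.
rewrite (card_joined jAB) (joined_indep_sumD1 jAB).
rewrite (rooted_tree_card tA) in pA fA *.
rewrite /=; set k := #|A|.-1 in pA fA *; set b := #|B| in pB fB *.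
have pk := rho_posW (leqnSn k) pA.
have rk := pk k (leqnn k); have rb := pB b (leqnn b).
have [q_lt le_f] := rooted_join_ltr (pos (A :|: B)) rk rb (pos B)
  (joined_bound jAB fA) (ltW (pos _)) fB.
have [pkb le_kb] := rho_supermult q_gt0 pk pB q_lt.
have le_f' : f (A :|: B) <= rho (k + b).+1 * (f (A :\ v) * f B).
  apply: le_trans le_f _; rewrite mulrC rhoS ler_pM2r ?mulr_gt0 //.
  by rewrite lerD2l lerN2 ler_pM2l // lef_pV2 ?posrE ?mulr_gt0 // pkb.
split=> // j; rewrite leq_eqVlt ltnS => /predU1P[->|]; last exact: pkb.
by have := lt_le_trans (pos (A :|: B)) le_f'; rewrite pmulr_lgt0 ?mulr_gt0.
Qed.

(** Cutting the tree between [a] and [b] makes the sum after both deletions a product; [rho_pair]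
    then yields the ratio of a path that loses both ends. *)
Lemma tree_pair_rho S a b : tree e S -> a \in S -> b \in S -> a != b ->
  [/\ (1 < #|S|)%N, rho_pos #|S|.-1
    & f S <= (rho #|S|.-1 - q) * f (S :\: [set a; b])].
Proof.
move=> tS aS bS ab.
have [A [B [a' [SE tA tB bB jAB]]]] := tree_split tS aS bS ab.
have [_ + _ _] := jAB; rewrite sub1set => a'B.
have [pA fA] := rooted_tree_rho tA.
have [pB fB] := rooted_tree_rho (tree_rooted tB a'B).
have [_ fBb] := rooted_tree_rho (tree_rooted tB bB).
have B0 : (0 < #|B|)%N by rewrite card_gt0; apply/set0Pn; exists b.
have fSD : f (S :\: [set a; b]) = f (A :\ a) * f (B :\ b).
  have [aA _ dAB eAB] := jAB.
  (* The neighbour [a'] may be [b] itself, hence the endpoint set [[set a'] :\ b]. *)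
  rewrite -setDDl SE -(@joined_indep_sumD1 A (B :\ b) a ([set a'] :\ b)).
    congr (f _); apply/setP => x; rewrite !inE.
    have [->|_] := eqVneq x b; last by [].
    by rewrite (disjointFl dAB) ?andbF.
  split=> //; first by rewrite setSD ?sub1set.
  exact: disjointWr (subD1set _ _) dAB.
  move=> x y xA /setD1P[yb yB]; rewrite eAB // !inE yb //.
rewrite fSD SE (card_joined jAB) /=.
rewrite (rooted_tree_card tA) in pA fA *.
rewrite /=; set k := #|A|.-1 in pA fA *; set m := #|B| in B0 pB fB fBb *.
have pk := rho_posW (leqnSn k) pA.
have rk := pk k (leqnn k); have rm := pB m (leqnn m).
have [q_lt le_f] := rooted_join_ltr (pos (A :|: B)) rk rm (pos B)
  (joined_bound jAB fA) (ltW (pos _)) fB.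
have [pkm _] := rho_supermult q_gt0 pk pB q_lt.
rewrite mulrC in q_lt; have := rho_pair q_gt0 B0 pB pk q_lt.
rewrite addnC rhoS => le_km; split=> //; first by rewrite ltnS addn_gt0 B0 orbT.
apply: le_trans le_f _.
rewrite -[leLHS]mulrA [leRHS]mulrCA ler_pM2l //.
apply: (@le_trans _ _ (rho m * f (B :\ b) * (1 - q / (rho k * rho m)))).
  rewrite ler_pM2r // subr_gt0 ltr_pdivrMr ?mul1r ?mulr_gt0 //.
  by rewrite mulrC.
rewrite mulrAC ler_pM2r //; apply: le_trans le_km.
by rewrite le_eqVlt; apply/orP; left; apply/eqP; field; rewrite !gt_eqF.
Qed.

(** A positive sum over [A :|: B] forces [q < (rho (#|B| - 1) - q) * rho (#|A| - 1)], the hypothesis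
    of [rho_cycle], and these indices add up to [#|S| - 2]. *)
Lemma cycle_split_rho S : cycle_split S ->
  rho_pos (#|S| - 2)%N /\ q *+ 2 < rho (#|S| - 2)%N.
Proof.
case=> v [A [B [a [b [SE tA tB ab jAB]]]]].
have [_ + _ _] := jAB; rewrite subUset !sub1set => /andP[aB bB].
have [pA fA] := rooted_tree_rho tA.
have [B1 pB fB] := tree_pair_rho tB aB bB ab.
rewrite SE (card_joined jAB) -(prednK (ltnW B1)) addnS subn2 /= addnC.
rewrite (rooted_tree_card tA) in pA fA *.
rewrite /=; set k := #|A|.-1 in pA fA *.
have pk := rho_posW (leqnSn k) pA; have rk := pk k (leqnn k).
apply: rho_cycle => //; first by rewrite -ltnS prednK // ltnW.
have := lt_le_trans (pos (A :|: B)) (joined_bound jAB fA).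
rewrite pmulr_rgt0 // subr_gt0 => lt_B.
have := lt_le_trans lt_B fB; rewrite ltr_pM2r //.
by rewrite ltr_pdivrMr.
Qed.
End LowerBound.
End Trees.

(** * Growth by leaves *)

Section UpperBound.
Variables (T : finType) (e : rel T).
Hypotheses (e_sym : symmetric e) (e_irr : irreflexive e).
Variables (K : realFieldType) (q : K).
Hypotheses (q_ge0 : 0 <= q) (nneg : forall S : {set T}, 0 <= indep_sum e S (- q)).
Implicit Types (S A B U : {set T}) (u v w : T).
Local Notation f S := (indep_sum e S (- q)).

Lemma indep_sum_setD_le S A : f S <= f (S :\: A).
Proof.
have le1 B v : f B <= f (B :\ v).
  have [vB|vB] := boolP (v \in B); last by rewrite (setDidPl _) // disjoint_sym disjoints1.
  by rewrite (indep_sumD1 e_sym e_irr _ vB) gerDl mulNr oppr_le0 mulr_ge0.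
have [n] := ubnP #|S :&: A|; elim: n S => // n IHn S Sn.
have [SA0|[v]] := set_0Vmem (S :&: A).
  by rewrite (setDidPl _) // -setI_eq0 SA0.
rewrite inE => /andP[vS vA].
apply: le_trans (le1 S v) _.
have -> : S :\: A = (S :\ v) :\: A.
  by rewrite setDDl; congr (_ :\: _); apply/setP => x; rewrite !inE; case: eqP => //= ->.
apply: IHn; rewrite -ltnS (leq_trans _ Sn) // ltnS (cardsD1 v (S :&: A)) inE vS vA.
by rewrite setIDAC.
Qed.

Lemma indep_sum1 v : f [set v] = 1 - q.
Proof.
by rewrite (indep_sumD1 e_sym e_irr _ (set11 v)) setDv set0D !indep_sum0 mulr1.
Qed.

Lemma indep_sum_edge u v : e u v -> f [set u; v] = 1 - q *+ 2.
Proof.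
move=> uv; rewrite (indep_sumD1 e_sym e_irr _ (set21 u v)).
have uNv : u != v by apply: contraTneq uv => ->; rewrite e_irr.
rewrite setU1K ?in_set1 // (_ : _ :\: _ = set0) ?indep_sum0 ?indep_sum1.
  by rewrite mulr1 mulr2n; ring.
by apply/eqP; rewrite setD_eq0 sub1set inE.
Qed.

Lemma indep_sum_le_pow S A : A \subset S ->
  f S <= (1 - q) ^+ (#|S| - #|A|) * f A.
Proof.
have [n] := ubnP #|S|; elim: n S => // n IHn S Sn AS.
have [->|neqAS] := eqVneq A S; first by rewrite subnn mul1r.
have /subsetPn[v vS vA] : ~~ (S \subset A) by rewrite eqEsubset AS in neqAS.
have AS' : A \subset S :\ v by rewrite subsetD1 AS.
have cS : #|S| = #|S :\ v|.+1 by rewrite (cardsD1 v S) vS.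
have q1 : 0 <= 1 - q by rewrite -(indep_sum1 v).
rewrite cS subSn ?subset_leq_card // exprS -mulrA.
apply: le_trans (ler_wpM2l q1 (IHn _ _ AS')); last by rewrite -ltnS -cS.
rewrite (indep_sumD1 e_sym e_irr _ vS) mulrBl mul1r mulNr lerD2l lerN2.
exact/ler_wpM2l/indep_sum_setD_le.
Qed.

Lemma indep_sum_leaf S u w : leaf_at e S u w ->
  f (u |: S) = f S - q * f (S :\ w).
Proof.
move=> [uS wS eu]; rewrite (indep_sumD1 e_sym e_irr _ (setU11 u S)) setU1K // mulNr.
congr (_ - _ * f _); apply/setP => x; rewrite !inE.
by case xS: (x \in S); rewrite ?andbF // eu.
Qed.

(** The left side is the value for the star on [#|S|] vertices. A new leaf costs [q] times the sum
    over [S :\ w], at most the value for isolated vertices, which is the cost in the star. *)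
Lemma tree_lower S : tree e S -> (1 - q) ^+ #|S|.-1 - q <= f S.
Proof.
case=> v0; elim=> {S} [|S u w gS IHS lf]; first by rewrite cards1 indep_sum1.
have [uS wS _] := lf; rewrite (indep_sum_leaf lf) cardsU1 uS /=.
have := indep_sum_le_pow (sub0set (S :\ w)); rewrite cards0 subn0 indep_sum0 mulr1.
move: IHS; rewrite (cardsD1 w S) wS /= => h1 h2.
rewrite exprS mulrBl mul1r.
have := ler_wpM2l q_ge0 h2; lra.
Qed.

Definition cycle_at S : Prop :=
  exists v B a b, [/\ S = v |: B, tree e B, a != b & joined e [set v] B v [set a; b]].

(** The left side is the value for [U_n]. Deleting [v] leaves the tree [B], bounded below by the
    star, and costs at most [q] times the value for [#|B| - 2] isolated vertices. *)
Lemma cycle_at_lower S : cycle_at S ->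
  (1 - q) ^+ (#|S| - 3) * (1 - q *+ 2) - q <= f S.
Proof.
case=> v [B [a [b [-> tB ab [_ abB dvB evB]]]]].
have vB : v \notin B by rewrite disjoints1 in dvB.
have cB : #|B| = #|B :\: [set a; b]|.+2.
  by rewrite cardsD (setIidPr abB) cards2 ab subn2 !prednK //;
     have := subset_leq_card abB; rewrite cards2 ab; lia.
rewrite (indep_sumD1 e_sym e_irr _ (setU11 v B)) setU1K //.
have -> : B :\: nbhs_of e v = B :\: [set a; b].
  apply/setP => x; rewrite !inE.
  by case xB: (x \in B); rewrite ?andbF // evB ?set11 // !inE eqxx.
have := tree_lower tB.
have := indep_sum_le_pow (sub0set (B :\: [set a; b])).
rewrite cards0 subn0 indep_sum0 mulr1 cardsU1 vB cB /= !subSS subn0 => h2 h1.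
have := ler_wpM2l q_ge0 h2; move: h1; rewrite exprS mulr2n.
set x := _ ^+ _; lra.
Qed.

(** An edge survives in [S :\ w], so a new leaf costs at most
    [q * (1 - q) ^+ (#|S| - 3) * (1 - q *+ 2)], exactly its cost in [U_n]. *)
Lemma grown_cycle_lower S0 S : cycle_at S0 ->
    (forall w, exists x y, [/\ x \in S0 :\ w, y \in S0 :\ w & e x y]) ->
  grown e S0 S -> (1 - q) ^+ (#|S| - 3) * (1 - q *+ 2) - q <= f S.
Proof.
move=> cyc edge; elim=> {S} [|S u w gS IHS lf]; first exact: cycle_at_lower.
have [uS wS _] := lf; rewrite (indep_sum_leaf lf) cardsU1 uS.
have S0S : S0 \subset S.
  by elim: gS => // S' u' w' _ sub _; rewrite (subset_trans sub) ?subsetUr.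
have [x [y [x0 y0 xy]]] := edge w.
have xyS : [set x; y] \subset S :\ w.
  by apply: subset_trans (setSD _ S0S); rewrite subUset !sub1set x0.
have xNy : x != y by apply: contraTneq xy => ->; rewrite e_irr.
have := indep_sum_le_pow xyS; rewrite (indep_sum_edge xy) cards2 xNy.
move: IHS (subset_leq_card xyS); rewrite cards2 xNy (cardsD1 w S) wS !add1n subSS.
case: #|S :\ w| => [//|[//|k]] IHS _; move: IHS; rewrite !subSS !subn0 exprS => h1 h2.
have := ler_wpM2l q_ge0 h2; lra.
Qed.
End UpperBound.

Lemma cycle_at_split (T : finType) (e : rel T) S : cycle_at e S -> cycle_split e S.
Proof.
case=> v [B [a [b [SE tB ab jB]]]]; exists v, [set v], B, a, b.
by split=> //; exact: RootedVertex.
Qed.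

(** * The extremal graphs *)

Lemma cycle_graphE m (i j : 'I_m.+3) : cycle_graph i j =
  [|| j == i.+1 :> nat, i == j.+1 :> nat,
      (i == 0%N :> nat) && (j == m.+2 :> nat)
    | (j == 0%N :> nat) && (i == m.+2 :> nat)].
Proof.
have ordSE (k l : 'I_m.+3) : (l == ordS k) =
    (l == k.+1 :> nat) || (l == 0%N :> nat) && (k == m.+2 :> nat).
  rewrite -val_eqE /=; have := ltn_ord k; have := ltn_ord l.
  move: (nat_of_ord k) (nat_of_ord l) => {}k {}l lm.
  rewrite ltnS leq_eqVlt => /predU1P[->|km]; first by rewrite modnn; lia.
  by rewrite modn_small //; lia.
by rewrite /cycle_graph !ordSE; lia.
Qed.

Lemma cycle_graph_sym n : symmetric (@cycle_graph n).
Proof. by move=> i j; rewrite /cycle_graph orbC. Qed.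

Lemma cycle_graph_irr m : irreflexive (@cycle_graph m.+3).
Proof. by move=> i; rewrite cycle_graphE; lia. Qed.

Lemma triangle_with_leaves_sym n : symmetric (@triangle_with_leaves n).
Proof.
move=> i j; rewrite /triangle_with_leaves eq_sym orbCA.
by rewrite [X in [|| _, _ | X]]andbC.
Qed.

Lemma triangle_with_leaves_irr n : irreflexive (@triangle_with_leaves n).
Proof. by move=> i; rewrite /triangle_with_leaves eqxx. Qed.

Section CycleGraph.
Variables (K : realFieldType) (q : K) (m : nat).
Local Notation f S := (indep_sum (@cycle_graph m.+3) S (- q)).
Local Notation rho := (rho q).

Definition arc_set (l k : nat) : {set 'I_m.+3} :=
  [set i : 'I_m.+3 | (l <= i < l + k)%N].

(** A proper arc induces a path, whose sum is a telescoping product of ratios; the condition on [l]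
    and [k] excludes the full cycle, whose end vertices are adjacent. *)
Lemma indep_sum_arc l k : (l + k <= m.+3)%N -> (0 < l)%N || (l + k < m.+3)%N ->
    (forall j : nat, (j < k)%N -> rho j != 0) ->
  f (arc_set l k) = \prod_(j < k) rho j.+1.
Proof.
move=> lk lk' n0.
have arc0 l' : arc_set l' 0 = set0 by apply/setP => i; rewrite !inE addn0; lia.
have arcS k' : (l + k'.+1 <= l + k)%N -> f (arc_set l k'.+1) =
    f (arc_set l k') - q * f (arc_set l k'.-1).
  move=> k'k; have t_lt : (l + k' < m.+3)%N by lia.
  have t_in : Ordinal t_lt \in arc_set l k'.+1 by rewrite inE /=; lia.
  rewrite (indep_sumD1 (@cycle_graph_sym _) (@cycle_graph_irr _) _ t_in) mulNr.
  congr (f _ - _ * f _); apply/setP => i; rewrite !inE -val_eqE /=.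
    lia.
  by rewrite cycle_graphE /=; have := ltn_ord i; lia.
suff H k' : (k' < k)%N -> f (arc_set l k'.+1) = rho k'.+1 * f (arc_set l k').
  have {H} : forall k', (k' <= k)%N -> f (arc_set l k') = \prod_(j < k') rho j.+1.
    elim=> [_|k' IH k'k]; first by rewrite arc0 indep_sum0 big_ord0.
    by rewrite H // IH ?(ltnW k'k) // big_ord_recr mulrC.
  exact.
elim: k' => [|k' IH] k'k.
  by rewrite arcS ?leq_add2l //= arc0 indep_sum0 rhoS /rho /= divr1; ring.
have IH' := IH (ltnW k'k); have r0 := n0 _ k'k.
rewrite arcS ?leq_add2l //= rhoS mulrBl mul1r; congr (_ - _).
by rewrite IH' mulrA divfK.
Qed.

(** Deleting the last vertex leaves paths on [m.+2] and [m] vertices. Beside their common factor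
    stands [rho m.+1 * rho m.+2 - q], which is [rho m.+1 - q *+ 2]. *)
Lemma indep_sum_cycle_gt0 :
    (forall j : nat, (j <= m.+1)%N -> 0 < rho j) -> q *+ 2 < rho m.+1 ->
  0 < f setT.
Proof.
move=> pos lt_q; have n0 (j : nat) : (j <= m.+1)%N -> rho j != 0.
  by move=> jm; rewrite gt_eqF ?pos.
have -> : f setT = f (arc_set 0 m.+2) - q * f (arc_set 1 m).
  rewrite (indep_sumD1 (@cycle_graph_sym _) (@cycle_graph_irr _) _ (in_setT ord_max)).
  rewrite mulNr; congr (f _ - _ * f _); apply/setP => i; rewrite !inE -val_eqE /=.
    by have := ltn_ord i; lia.
  by rewrite cycle_graphE /=; have := ltn_ord i; lia.
have arcE l k : (l + k <= m.+3)%N -> (k <= m.+2)%N -> (0 < l)%N || (l + k < m.+3)%N ->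
    f (arc_set l k) = \prod_(j < k) rho j.+1.
  by move=> lk km lk'; apply: indep_sum_arc => // j jk; apply: n0; lia.
rewrite !arcE; try lia.
rewrite 2!big_ord_recr /= -mulrA [q * _]mulrC -mulrBr pmulr_rgt0.
  rewrite (rhoS q m.+1) mulrBr mulr1 [rho m.+1 * _]mulrC divfK ?n0 //.
  by rewrite -addrA -opprD -mulr2n subr_gt0.
by apply: prodr_gt0 => j _; apply: pos; have := ltn_ord j; lia.
Qed.
End CycleGraph.

Section TriangleWithLeaves.
Variables (K : realFieldType) (q : K) (m : nat).
Local Notation f S := (indep_sum (@triangle_with_leaves m.+3) S (- q)).

(** Without the centre there remain one edge and [m] isolated vertices; the centre is adjacent to
    all of them, so its own term is [- q]. *)
Lemma triangle_with_leaves_le : 0 <= q -> (forall S, 0 <= f S) ->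
  f setT <= (1 - q) ^+ m * (1 - q *+ 2) - q.
Proof.
move=> q0 nneg; pose sym := @triangle_with_leaves_sym m.+3.
pose irr := @triangle_with_leaves_irr m.+3.
rewrite (indep_sumD1 sym irr _ (in_setT ord0)).
have -> : [set: 'I_m.+3] :\ ord0 :\: nbhs_of (@triangle_with_leaves m.+3) ord0 = set0.
  by apply/setP => i; rewrite !inE /triangle_with_leaves /= eq_sym; case: eqP.
rewrite indep_sum0 mulr1 lerD2r.
pose x : 'I_m.+3 := @Ordinal m.+3 1 isT; pose y : 'I_m.+3 := @Ordinal m.+3 2 isT.
have xy : [set x; y] \subset [set: 'I_m.+3] :\ ord0.
  by rewrite subUset !sub1set !inE.
have := indep_sum_le_pow sym irr q0 nneg xy.
rewrite (indep_sum_edge sym irr) //= cards2 /=.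
have -> : #|[set: 'I_m.+3] :\ ord0| = m.+2.
  by have := cardsT 'I_m.+3; rewrite (cardsD1 ord0) inE card_ord; case.
by rewrite subn2.
Qed.
End TriangleWithLeaves.

(** * Induced cycles: opening at a vertex and surviving edges *)

Definition induced_cycle (T : finType) (e : rel T) m (h : 'I_m.+3 -> T) : Prop :=
  injective h /\ forall i j, e (h i) (h j) = cycle_graph i j.

Section InducedCycle.
Variables (T : finType) (e : rel T) (m : nat) (h : 'I_m.+3 -> T).
Hypothesis h_cycle : induced_cycle e h.

Lemma induced_cycle_tree : tree e (h @: [set~ ord0]).
Proof.
have [h_inj eh] := h_cycle.
pose initial k : {set 'I_m.+3} := [set i : 'I_m.+3 | (0 < i <= k.+1)%N].
have prefix k : (k <= m.+1)%N -> tree e (h @: initial k).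
  elim: k => [_|k IH km].
    have -> : initial 0%N = [set inord 1].
      by apply/setP => i; rewrite !inE -val_eqE /= inordK //; lia.
    by rewrite imset_set1; exists (h (inord 1)); exact: GrownBase.
  have lf : leaf_at e (h @: initial k) (h (inord k.+2)) (h (inord k.+1)).
    split; rewrite ?(mem_imset _ _ h_inj) ?inE ?inordK //; try lia.
    move=> _ /imsetP[i + ->]; rewrite inE => i_k.
    rewrite eh (inj_eq h_inj) cycle_graphE -val_eqE /= !inordK //; lia.
  have -> : initial k.+1 = inord k.+2 |: initial k.
    by apply/setP => i; rewrite !inE -val_eqE /= inordK //; lia.
  by rewrite imsetU imset_set1; apply: tree_leaf (IH (ltnW km)) lf.
have -> : [set~ ord0] = initial m.+1; last exact: prefix.
by apply/setP => i; rewrite !inE -val_eqE /=; have := ltn_ord i; lia.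
Qed.

Lemma induced_cycle_at : cycle_at e (h @: setT).
Proof.
have [h_inj eh] := h_cycle.
exists (h ord0), (h @: [set~ ord0]), (h (inord 1)), (h ord_max); split.
- by rewrite -imset_set1 -imsetU setUCr.
- exact: induced_cycle_tree.
- by rewrite (inj_eq h_inj) -val_eqE /= inordK.
split; rewrite ?set11 //.
- by rewrite subUset !sub1set !(mem_imset _ _ h_inj) !inE -!val_eqE /= inordK.
- by rewrite disjoints1 (mem_imset _ _ h_inj) !inE eqxx.
move=> _ _ /set1P -> /imsetP[i + ->]; rewrite !inE => i0.
rewrite eqxx eh !(inj_eq h_inj) cycle_graphE -!val_eqE /= inordK //.
by move: i0; rewrite -val_eqE /=; lia.
Qed.

(** Whichever vertex [w] is, it misses one of the edges between the indices 0 and 1, 1 and 2, or 0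
    and [m.+2]. *)
Lemma induced_cycle_edge w :
  exists x y, [/\ x \in h @: setT :\ w, y \in h @: setT :\ w & e x y].
Proof.
have [h_inj eh] := h_cycle.
have edge i j : cycle_graph i j -> h i != w -> h j != w ->
    exists x y, [/\ x \in h @: setT :\ w, y \in h @: setT :\ w & e x y].
  by move=> ij iw jw; exists (h i), (h j); rewrite !inE iw jw !imset_f ?inE ?eh.
have ne i j : h i = w -> i != j -> h j != w.
  by move=> <- ij; rewrite (inj_eq h_inj) eq_sym.
pose i k : 'I_m.+3 := inord k.
have iE k : (k < m.+3)%N -> i k = k :> nat by exact: inordK.
have i_neq k l : (k < m.+3)%N -> (l < m.+3)%N -> k != l -> i k != i l.
  by move=> km lm kl; rewrite -val_eqE /= !iE.
have [w0|w0] := eqVneq (h (i 0%N)) w.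
  apply: (edge (i 1%N) (i 2)); first by rewrite cycle_graphE !iE.
    by apply: ne w0 _; rewrite i_neq.
  by apply: ne w0 _; rewrite i_neq.
have [w1|w1] := eqVneq (h (i 1%N)) w.
  apply: (edge (i 0%N) (i m.+2)) => //; first by rewrite cycle_graphE !iE ?eqxx ?orbT.
  by apply: ne w1 _; rewrite i_neq.
by apply: (edge (i 0%N) (i 1%N)) => //; rewrite cycle_graphE !iE.
Qed.
End InducedCycle.

(** * Structure of connected unicyclic graphs *)

Section Unicyclic.
Variables (T : finType) (e : rel T).
Hypotheses (e_sym : symmetric e) (e_irr : irreflexive e)
  (e_conn : forall x y, connect e x y).
Variable c : seq T.
Hypotheses (c_cycle : ucycle e c) (c_size : (2 < size c)%N)
  (c_unique : forall d, ucycle e d -> (2 < size d)%N ->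
     cycle_edges d = cycle_edges c).
Local Notation cset := [set x in c].

Lemma cycle_edge_next d x : ucycle e d -> (2 < size d)%N -> x \in d ->
  exists2 z, z \in c & [set x; next d x] = [set z; next c z].
Proof.
move=> d_cycle d_size xd.
have : [set x; next d x] \in cycle_edges c.
  by rewrite -(c_unique d_cycle d_size); apply: imset_f.
by case/imsetP => z zc ->; exists z.
Qed.

(** A chord would close an arc of [c] to a cycle. By uniqueness the edges of that cycle are edges of
    [c], so the chord joins consecutive vertices. *)
Lemma unicyclic_chordless x y : x \in c -> y \in c -> e x y ->
  y = next c x \/ x = next c y.
Proof.
move=> xc yc exy.
have xNy : y != x by apply: contraTneq exy => ->; rewrite e_irr.
have [c_cyc c_uniq] := andP c_cycle.
have [i c' rotE] := rot_to xc.
have [y_next|y_next] := eqVneq y (next c x); [by left|right].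
have yc' : y \in c'.
  by have := yc; rewrite -(mem_rot i) rotE inE (negbTE xNy).
move: c_cyc c_uniq; rewrite -(rot_cycle i) -(rot_uniq i) rotE /=.
case/splitPr: yc' rotE => c1 c2 rotE.
rewrite rcons_cat cat_path /= mem_cat inE cat_uniq /= !negb_or.
move=> /and3P[p1 p2 _] /andP[/and3P[x1 _ _] /and3P[u1 /andP[y1 _] _]].
have d_cycle : ucycle e (x :: rcons c1 y).
  rewrite /ucycle /= rcons_path rcons_path p1 p2 last_rcons e_sym exy.
  by rewrite mem_rcons inE eq_sym negb_or xNy x1 rcons_uniq y1 u1.
(* The arc [c1] is nonempty because [y] is not the successor of [x]. *)
have d_size : (2 < size (x :: rcons c1 y))%N.
  rewrite /= size_rcons; case: c1 rotE {p1 p2 x1 u1 y1 d_cycle} => // rotE.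
  by move: y_next; rewrite -(next_rot i (proj2 (andP c_cycle))) rotE /= eqxx eqxx.
have yd : y \in x :: rcons c1 y by rewrite inE mem_rcons mem_head orbT.
have [z zc] := cycle_edge_next d_cycle d_size yd.
have -> : next (x :: rcons c1 y) y = x.
  rewrite next_nth yd nth_default //= eq_sym (negbTE xNy) size_rcons -cats1 index_cat.
  by rewrite (negbTE y1) /= eqxx addn0.
move=> /setP zE; have := zE y; have := zE x; rewrite !inE !eqxx orbT /=.
move=> /esym/orP[/eqP xz|/eqP xz] /esym/orP[/eqP yz|/eqP yz].
- by rewrite xz yz eqxx in xNy.
- by rewrite xz -yz eqxx in y_next.
- by rewrite yz.
- by rewrite xz yz eqxx in xNy.
Qed.

Lemma grown_sub S : grown e cset S -> cset \subset S.
Proof. by elim=> // S' u w _ sub _; rewrite (subset_trans sub) ?subsetUr. Qed.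

Definition restr (S : {set T}) : rel T :=
  [rel x y | [&& x \in S, y \in S & e x y]].

Lemma grown_connect S x y : grown e cset S -> x \in S -> y \in S ->
  connect (restr S) x y.
Proof.
have restr_sym S' : connect_sym (restr S').
  by apply: sym_connect_sym => u v; rewrite /restr /= andbCA e_sym.
move=> gS; elim: gS x y => {S} [|S u w gS IHS [uS wS eu]] x y.
  rewrite !inE => xc yc; apply: (connect_cycle _ xc yc).
  apply: (@sub_in_cycle _ (mem c) e); last by case/andP: c_cycle.
    by move=> u v uc vc uv; rewrite /restr /= !inE uv andbT; apply/andP.
  exact/allP.
have IH a b : a \in S -> b \in S -> connect (restr (u |: S)) a b.
  move=> aS bS; apply: connect_sub (IHS _ _ aS bS) => a' b' /= /and3P[a'S b'S ab'].
  by apply: connect1; rewrite /restr /= !inE a'S b'S !orbT.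
have uw : connect (restr (u |: S)) u w.
  by apply: connect1; rewrite /restr /= !inE eqxx wS orbT eu ?eqxx.
rewrite !inE => /predU1P[->|xS] /predU1P[->|yS].
- exact: connect0.
- exact: connect_trans uw (IH _ _ wS yS).
- by rewrite restr_sym; exact: connect_trans uw (IH _ _ wS xS).
- exact: IH.
Qed.

(** Connectivity gives an edge leaving [S]. A second neighbour in [S] of its outer end [u] would
    close a path inside [S] to a cycle through [u], while the unique cycle lies in [S]. *)
Lemma grown_leaf S : grown e cset S -> S != setT -> exists u w, leaf_at e S u w.
Proof.
move=> gS neqS; have sub := grown_sub gS.
have [x0 x0S] : exists x, x \in S.
  by case: c c_size sub => // x s _ /subsetP sub; exists x; apply: sub; rewrite inE mem_head.
have [w [u [wS uS wu]]] : exists w u, [/\ w \in S, u \notin S & e w u].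
  have /existsP[w /existsP[u /and3P[wS uS wu]]] :
      [exists w, exists u, [&& w \in S, u \notin S & e w u]].
    apply: contraNT neqS => no_edge; rewrite -subTset; apply/subsetP => y _.
    have cl : closed e (mem S).
      apply: intro_closed => [|a b ab aS]; first exact: sym_connect_sym.
      apply: contraNT no_edge => bS; apply/existsP; exists a.
      by apply/existsP; exists b; rewrite aS bS.
    by have := closed_connect cl (e_conn x0 y); rewrite /= x0S.
  by exists w, u.
exists u, w; split=> // x xS; apply/idP/eqP => [ux|->]; last by rewrite e_sym.
apply/eqP; apply: contraNT uS => xw.
have /connectP[p0 p0_path x_last] := grown_connect gS wS xS.
case/shortenP: p0_path x_last => p p_path p_uniq _ x_last.
have pS : {subset w :: p <= S}.
  move=> z; rewrite inE => /predU1P[->//|].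
  elim: p w p_path {wS wu p_uniq x_last xw} => //= a p IHp w /andP[/and3P[_ aS _] ap].
  by rewrite inE => /predU1P[->//|]; apply: IHp ap.
apply: contraT => uS.
have d_cycle : ucycle e (u :: w :: p).
  apply/andP; split; last by rewrite cons_uniq p_uniq andbT; apply: contra uS; apply: pS.
  rewrite /= rcons_path e_sym wu -x_last e_sym ux andbT /=.
  by apply: sub_path p_path => a b /and3P[].
have d_size : (2 < size (u :: w :: p))%N.
  by case: p x_last {p_path p_uniq pS d_cycle} => //= xw'; rewrite xw' eqxx in xw.
have [z zc] := cycle_edge_next d_cycle d_size (mem_head _ _).
move=> /setP/(_ u); rewrite !inE eqxx /= => /esym/orP[/eqP uz|/eqP uz].
  by rewrite uz (subsetP sub) // inE in uS.
by rewrite uz (subsetP sub) // inE mem_next in uS.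
Qed.

Lemma grown_all : grown e cset setT.
Proof.
suff H n S : (#|~: S| <= n)%N -> grown e cset S -> grown e cset setT.
  by apply: (H #|~: cset| cset) => //; exact: GrownBase.
elim: n S => [|n IHn] S.
  by rewrite leqn0 cards_eq0 => /eqP SC; rewrite -[X in grown _ _ X -> _]setCK SC setC0.
move=> Sn gS; have [<-//|neqS] := eqVneq S setT.
have [u [w lf]] := grown_leaf gS neqS; apply: IHn (GrownLeaf gS lf).
have [uS _ _] := lf; rewrite -ltnS (leq_trans _ Sn) //.
rewrite [in leqRHS](cardsD1 u) inE uS ltnS subset_leq_card //.
by apply/subsetP => y; rewrite !inE negb_or.
Qed.

Lemma unicyclic_induced_cycle :
  exists m (h : 'I_m.+3 -> T), induced_cycle e h /\ cset = h @: setT.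
Proof.
have [c_cyc c_uniq] := andP c_cycle.
have [m sizeE] : exists m, size c = m.+3.
  by exists (size c - 3)%N; move: c_size; lia.
have [x0 [s cE]] : exists x0 s, c = x0 :: s by case: c sizeE => // x0 s; exists x0, s.
pose h (i : 'I_m.+3) := nth x0 c i.
have h_inj : injective h.
  by move=> i j /eqP; rewrite nth_uniq ?sizeE // => /eqP/val_inj.
have h_in i : h i \in c by rewrite mem_nth ?sizeE.
have next_h i : next c (h i) = h (ordS i).
  rewrite next_nth h_in {1}cE /h index_uniq ?sizeE //=.
  have := ltn_ord i; rewrite ltnS leq_eqVlt => /predU1P[->|im].
    (* At the last index [nth] runs off the tail and returns its default, the head of [c], in
       agreement with the wrap of [ordS]. *)
    by rewrite modnn cE nth_default //=; move: sizeE; rewrite cE /= => -[->].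
  by rewrite modn_small //= cE.
exists m, h; split; last first.
  apply/setP => x; rewrite inE; apply/idP/imsetP => [xc|[i _ ->]]; last exact: h_in.
  have xi : (index x c < m.+3)%N by rewrite -sizeE index_mem.
  by exists (Ordinal xi); rewrite // /h /= nth_index.
split=> // i j; apply/idP/orP => [eij|].
  have [] := unicyclic_chordless (h_in i) (h_in j) eij; rewrite next_h => /h_inj ->.
    by left.
  by right.
have h_next k : e (h k) (h (ordS k)) by rewrite -next_h next_cycle.
by case=> /eqP ->; rewrite // e_sym.
Qed.
End Unicyclic.

Theorem corollary2p8 (R : realType) (n : nat) (T : finType) (e : rel T)
    (card_T : #|T| = n) (unicyclic_e : connected_unicyclic e) :
  xi R (@cycle_graph n) <= xi R e /\
  xi R e <= xi R (@triangle_with_leaves n).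
Proof.
case: unicyclic_e => [[e_sym e_irr] [T_gt0 e_conn] [C [[c [c_cycle c_size CE]] C_unique]]].
have c_unique d : ucycle e d -> (2 < size d)%N -> cycle_edges d = cycle_edges c.
  by move=> dc ds; rewrite -CE; symmetry; apply: C_unique; exists d.
have gT := grown_all e_sym e_conn c_cycle c_size c_unique.
have [m0 [h [h_cycle csetE]]] :=
  unicyclic_induced_cycle e_sym e_irr c_cycle c_size c_unique.
rewrite csetE in gT.
have c_at := induced_cycle_at h_cycle.
have n3 : (2 < n)%N.
  rewrite -card_T (leq_trans c_size) // -(card_uniqP _) ?max_card //.
  by case/andP: c_cycle.
have [m nE] : exists m, n = m.+3 by exists (n - 3)%N; lia.
rewrite nE in card_T * => {n n3 nE}.
have [rG0 fG posG nnegG] := xi_shearer_radius R e_sym e_irr T_gt0.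
have ord_gt0 : (0 < #|'I_m.+3|)%N by rewrite card_ord.
split.
  have [rC0 fC _ _] :=
    xi_shearer_radius R (@cycle_graph_sym m.+3) (@cycle_graph_irr m) ord_gt0.
  rewrite -lerN2 leNgt; apply/negP => lt_r.
  (* At the zero of the cycle all sums for [e] would still be positive, which makes the sum for the
     cycle positive too. *)
  have pos (S : {set T}) : 0 < indep_sum e S (- - xi R (@cycle_graph m.+3)).
    by apply: posG; rewrite ?subsetT // lt_r ltW.
  have [rho_pos lt_rho] := cycle_split_rho e_sym e_irr rC0 pos
    (grown_cycle_split e_sym gT (cycle_at_split c_at)).
  rewrite cardsT card_T subn2 /= in rho_pos lt_rho.
  by have := indep_sum_cycle_gt0 rho_pos lt_rho; rewrite fC ltxx.
have [rU0 _ posU _] := xi_shearer_radius R (@triangle_with_leaves_sym m.+3)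
  (@triangle_with_leaves_irr m.+3) ord_gt0.
rewrite -lerN2 leNgt; apply/negP => lt_r.
(* At the zero of [e] the sum for [U_n] would be positive, yet it is at most the sum for [e], which
   is 0. *)
have pos S : 0 < indep_sum (@triangle_with_leaves m.+3) S (- - xi R e).
  by apply: posU; rewrite ?subsetT // lt_r ltW.
have := triangle_with_leaves_le (ltW rG0) (fun S => ltW (pos S)).
have := grown_cycle_lower e_sym e_irr (ltW rG0) (fun S => nnegG S (subsetT S))
  c_at (induced_cycle_edge h_cycle) gT.
rewrite fG cardsT card_T subSS subSS subSS subn0 => h1 h2.
by have := lt_le_trans (pos setT) (le_trans h2 h1); rewrite ltxx.
Qed.
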